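(* Let $\mathbb K$ be a non-Archimedean valued field with nontrivial valuation, let $X$ be a separable $F$-space over $\mathbb K$ and let $T:X\to X$ be a continuous linear operator. The following statements are equivalent: (i) $T$ is hypercyclic; (ii) $T$ is topologically transitive, that is, for each pair of non-empty open sets $U,V\subset X$ there exists $n\in\mathbb N$ such that $T^n(U)\cap V\neq\varnothing$.
   Context: A non-Archimedean valued field is a commutative field $\mathbb K$ with a map $|\cdot|:\mathbb K\to[0,+\infty)$ such that $|\lambda|=0$ iff $\lambda=0$, $|\lambda\mu|=|\lambda||\mu|$, and $|\lambda+\mu|\le\max\{|\lambda|,|\mu|\}$; the valuation is always assumed nontrivial. An $F$-space is a topological vector space over $\mathbb K$ which is metrizable and complete. A continuous linear operator $T$ on a topological vector space $X$ is hypercyclic if there exists $\mathbf x\in X$ whose orbit $\{T^n(\mathbf x): n\in\mathbb Z,\ n\ge 0\}$ is dense in $X$. $\mathbb N=\{1,2,3,\dots\}$. *)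

(* Defs.v *)
From HB Require Import structures.
From mathcomp Require Import all_boot all_order all_algebra.
From mathcomp Require Import all_classical all_reals all_analysis.

Set Implicit Arguments.
Unset Strict Implicit.
Unset Printing Implicit Defensive.

Import Order.TTheory GRing.Theory Num.Theory.

Local Open Scope classical_set_scope.
Local Open Scope ring_scope.

(* The valuation has real values, so it cannot be the library norm `|x|, which
   takes values in the scalar field itself. *)
HB.mixin Record Field_isNonArchValued (R : realType) K & GRing.Field K := {
  valuation : K -> R ;
  valuation_ge0 : forall x, 0 <= valuation x ;
  valuation_eq0 : forall x, valuation x = 0 <-> x = 0 ;
  valuationM : forall x y, valuation (x * y) = valuation x * valuation y ;
  valuationD_max : forall x y,
    valuation (x + y) <= Num.max (valuation x) (valuation y)
}.

#[short(type="nonArchFieldType")]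
HB.structure Definition NonArchField (R : realType) :=
  {K of GRing.Field K & Field_isNonArchValued R K}.

Section valuation_metric.
Variables (R : realType) (K : nonArchFieldType R).

Let dist (x y : K) : R := valuation (x - y).

Let valuation1 : valuation (1 : K) = 1.
Proof.
have v1 : valuation (1 : K) != 0.
  by apply/eqP => /valuation_eq0/eqP; rewrite oner_eq0.
by apply: (mulfI v1); rewrite -valuationM !mulr1.
Qed.

Let valuationN (x : K) : valuation (- x) = valuation x.
Proof.
have vN1 : valuation (-1 : K) = 1.
  have /eqP : valuation (-1 : K) ^+ 2 = 1.
    by rewrite expr2 -valuationM mulN1r opprK valuation1.
  rewrite sqrf_eq1 => /orP[/eqP //|/eqP vN].
  by have := valuation_ge0 (-1 : K); rewrite vN oppr_ge0 ler10.
by rewrite -mulN1r valuationM vN1 mul1r.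
Qed.

Let distxx x : dist x x = 0.
Proof. by rewrite /dist subrr; apply/valuation_eq0. Qed.

Let dist_positivity x y : dist x y = 0 -> x = y.
Proof. by move/valuation_eq0/eqP; rewrite subr_eq0 => /eqP. Qed.

Let dist_sym x y : dist x y = dist y x.
Proof. by rewrite /dist -opprB valuationN. Qed.

Let dist_triangle y x z : dist x z <= dist x y + dist y z.
Proof.
have -> : dist x z = valuation ((x - y) + (y - z)) by rewrite /dist addrA subrK.
apply: le_trans (valuationD_max _ _) _.
by rewrite ge_max lerDl lerDr !valuation_ge0.
Qed.

HB.instance Definition _ := isMetric.Build R (NonArchField.sort K)
  distxx dist_positivity dist_sym dist_triangle.

End valuation_metric.

Definition nontrivial_valuation (R : realType) (K : nonArchFieldType R) : Prop :=
  exists x : K, x != 0 /\ valuation x != 1.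

(* A structure extending both [GRing.Lmodule K] and the topological hierarchy is
   possible only for an ordered [K], because of the library's [NbhsLmodule]. So
   the scaling is given by the axioms of [GRing.Zmodule_isLmodule], and the
   [lmodType] structure is derived below. The library's [Tvs] moreover imposes
   local convexity. *)
HB.mixin Record TopologicalZmodule_isTopologicalVectorSpace (R : realType)
    (K : nonArchFieldType R) X & TopologicalZmodule X := {
  tvs_scale : K -> X -> X ;
  tvs_scaleA : forall a b v, tvs_scale a (tvs_scale b v) = tvs_scale (a * b) v ;
  tvs_scale1 : left_id 1 tvs_scale ;
  tvs_scaleDr : right_distributive tvs_scale +%R ;
  tvs_scaleDl : forall v, {morph tvs_scale^~ v : a b / a + b} ;
  tvs_scale_continuous : continuous (fun z : K * X => tvs_scale z.1 z.2)
}.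

#[short(type="topVectorSpaceType")]
HB.structure Definition TopologicalVectorSpace (R : realType)
    (K : nonArchFieldType R) :=
  {X of TopologicalZmodule X
      & TopologicalZmodule_isTopologicalVectorSpace R K X}.

HB.instance Definition _ (R : realType) (K : nonArchFieldType R)
    (X : topVectorSpaceType K) :=
  GRing.Zmodule_isLmodule.Build K (TopologicalVectorSpace.sort X)
    tvs_scaleA tvs_scale1 tvs_scaleDr tvs_scaleDl.

Definition metrizable (R : realType) (X : topologicalType) : Prop :=
  exists d : X -> X -> R,
    [/\ forall x y, d x y = 0 <-> x = y,
        forall x y, d x y = d y x,
        forall x y z, d x z <= d x y + d y z
      & forall x, nbhs x = filter_from [set e | 0 < e]
                                       (fun e => [set y | d x y < e])].

(* Completeness for the uniformity that a topological abelian group carries; the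
   library's [cauchy] needs a [uniformType], and a metrizable space does not come
   with one. *)
Definition cauchy_filter (X : topologicalZmodType) (F : set_system X) : Prop :=
  z.1 - z.2 @[z --> (F, F)] --> (0 : X).

Definition complete (X : topologicalZmodType) : Prop :=
  forall F : set_system X, ProperFilter F -> cauchy_filter F ->
    exists x : X, F --> x.

Definition F_space (R : realType) (K : nonArchFieldType R)
    (X : topVectorSpaceType K) : Prop :=
  metrizable R X /\ complete X.

Definition separable (X : topologicalType) : Prop :=
  exists2 D : set X, countable D & dense D.

Definition hypercyclic (X : topologicalType) (T : X -> X) : Prop :=
  exists x : X, dense [set iter n T x | n in [set: nat]].

Definition topologically_transitive (X : topologicalType) (T : X -> X) : Prop :=
  forall U V : set X, open U -> open V -> U !=set0 -> V !=set0 ->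
    exists n : nat, (0 < n)%N /\ (iter n T @` U) `&` V !=set0.

(* Main.v *)
Require Import Defs.
From mathcomp Require Import all_boot all_order all_algebra.
From mathcomp Require Import all_classical all_reals all_analysis.

(** Both implications are topological; the vector space structure enters only
through the absence of isolated points.

Hypercyclic implies transitive.  If the orbit of [x] is dense, it visits [U],
say at time [n].  In an accessible space without isolated points a non-empty
open set stays open and non-empty after finitely many points are removed, so the
orbit also visits [V] outside its first [n + 1] points, hence at a time [m > n];
then [m - n] iterations take a point of [U] into [V]
([hypercyclic_topologically_transitive]).  A nonzero topological vector space
over [K] has no isolated point because a nontrivial valuation provides nonzero
scalars arbitrarily close to [0], which move [x] to nearby points [c *: y + x]
([topological_vector_space_perfect]).  In the zero space every two non-empty
sets meet, so transitivity is immediate there.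

Transitive implies hypercyclic.  This is Birkhoff's argument.  Separability
gives a sequence of non-empty open sets [B n] such that a set meeting all of
them is dense ([metrizable_separable_countable_pi_base]).  The set of points
whose orbit meets [B n] is open by continuity and dense by transitivity, so
Baire's theorem yields a point whose orbit meets every [B n].  Completeness is
that of the group uniformity and the given metric need be neither complete nor
translation invariant, so Baire's theorem is proved for topological groups
([metrizable_complete_baire]): the nested sets are made small by controlling
their differences in place of their diameters. *)

Import Order.TTheory GRing.Theory Num.Theory.

Local Open Scope classical_set_scope.
Local Open Scope ring_scope.

(** * Consequences of metrizability *)

Lemma metrizable_nbhs_countable_base (R : realType) (X : topologicalType)
    (x : X) :
  metrizable R X ->
  exists2 W : nat -> set X, forall k, nbhs x (W k) &
    forall A, nbhs x A -> exists k, W k `<=` A.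
Proof.
move=> [d [d0 dC dT nbhsd]].
exists (fun k => [set y | d x y < k.+1%:R^-1]) => [k|A].
  by rewrite nbhsd; exists k.+1%:R^-1 => //=; rewrite invr_gt0.
rewrite nbhsd => -[e /= e0 eA].
have [k] := ltr_add_invr e0; rewrite add0r => ke.
by exists k; apply: subset_trans eA => y /= xy; exact: lt_trans ke.
Qed.

Lemma metrizable_accessible (R : realType) (X : topologicalType) :
  metrizable R X -> accessible_space X.
Proof.
move=> [d [d0 dC dT nbhsd]] x y xy.
have dge0 u v : 0 <= d u v.
  have := dT u v u; rewrite (d0 u u).2// (dC v u) -mulr2n.
  by rewrite pmulrn_lge0.
have dxy : 0 < d x y.
  by rewrite lt_neqAle dge0 andbT eq_sym; apply: contra xy => /eqP/d0 ->.
have : nbhs x [set z | d x z < d x y] by rewrite nbhsd; exists (d x y).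
rewrite nbhsE => -[A [oA Ax] Axy]; exists A; split => //; rewrite inE//.
by move/Axy => /=; rewrite ltxx.
Qed.

Lemma metrizable_regular (R : realType) (X : topologicalType) :
  metrizable R X -> regular_space X.
Proof.
move=> [d [d0 dC dT nbhsd]] x A xA; have : nbhs x A := xA.
rewrite nbhsd => -[e /= e0 eA].
have e20 : 0 < e / 2 by rewrite divr_gt0.
have nb y : nbhs y [set z | d y z < e / 2] by rewrite nbhsd; exists (e / 2).
exists [set y | d x y < e / 2]; first by exists (e / 2).
move=> y cy; apply: eA => /=; have [z [/= xz yz]] := cy _ (nb y).
by rewrite (le_lt_trans (dT _ z _))// (splitr e) ltrD// dC.
Qed.

(** A [B n] inside each non-empty open set suffices to test density; this weaker
form of a base is met by the interiors of the balls of radius [1 / (k + 1)]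
around the points of a countable dense set, indexed by pairs [(i, k)] encoded as
natural numbers. *)
Lemma metrizable_separable_countable_pi_base (R : realType)
    (X : topologicalType) :
  metrizable R X -> separable X -> [set: X] !=set0 ->
  exists2 B : nat -> set X, forall n, open (B n) /\ B n !=set0 &
    forall O, O !=set0 -> open O -> exists n, B n `<=` O.
Proof.
move=> [d [d0 dC dT nbhsd]] [D cD dD] X0.
have [D0|[g]] := pfcard_geP cD.
  by have [x []] := dD setT X0 openT; rewrite D0.
pose b q k := [set y | d q y < k.+1%:R^-1].
have nb q k : nbhs q (b q k).
  by rewrite nbhsd; exists k.+1%:R^-1 => //=; rewrite invr_gt0.
pose B n := if unpickle n is Some (i, k) then interior (b (g i) k) else setT.
exists B => [n|].
  rewrite /B; case: unpickle => [[i k]|]; last by split=> //; exact: openT.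
  by split; [exact: open_interior|exists (g i); exact: nb].
move=> O [x Ox] oO.
have : nbhs x O by exact: open_nbhs_nbhs.
rewrite nbhsd => -[e /= e0 eO].
have e20 : 0 < e / 2 by rewrite divr_gt0.
(* Half of [e] for reaching a dense point [q], half for the ball around it. *)
have [k] := ltr_add_invr e20; rewrite add0r => ke.
have [q [/interior_subset xq Dq]] : interior (b x k) `&` D !=set0.
  by apply: dD; [exists x; exact: nb|exact: open_interior].
have [i _ giq] := @surj _ _ _ _ g _ Dq.
exists (pickle (i, k)); rewrite /B pickleK giq => y /interior_subset qy; apply: eO => /=.
by rewrite (le_lt_trans (dT _ q _))// (splitr e) ltrD// (lt_trans _ ke).
Qed.

(** * Baire category in metrizable complete abelian groups *)

Lemma nbhs_open_small (X : topologicalZmodType) (x : X) (W : set X) :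
  nbhs 0 W ->
  exists2 A : set X, open_nbhs x A & forall a b, A a -> A b -> W (a - b).
Proof.
move=> W0; have : nbhs (x - x) W by rewrite subrr.
move/(@sub_continuous X (x, x)) => -[[A B] /= [xA xB] AB].
have : nbhs x (A `&` B) by exact: filterI.
rewrite nbhsE => -[C xC CAB]; exists C => // a b Ca Cb.
by apply: (AB (a, b)); split => /=; [case: (CAB _ Ca)|case: (CAB _ Cb)].
Qed.

(** Shrinking [O] step by step gives open sets [F n] with the closure of
[F n.+1] inside [F n] and [U n], and with all differences of points of [F n.+1]
in the [n]-th member of a countable base of neighborhoods of [0].  The last
condition makes the filter generated by the [F n] Cauchy, and its limit lies in
every closure. *)
Lemma metrizable_complete_baire (R : realType) (X : topologicalZmodType)
    (U : nat -> set X) :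
  metrizable R X -> complete X ->
  (forall n, open (U n)) -> (forall n, dense (U n)) -> dense (\bigcap_n U n).
Proof.
move=> mX cX oU dU O O0 oO.
have [W W0 Wbase] := metrizable_nbhs_countable_base R X 0 mX.
(* The hypotheses on [p.2] sit below the existential so that choice produces a
   total function, which can then be iterated from [O]. *)
have refine (p : nat * set X) : exists B : set X, open p.2 -> p.2 !=set0 ->
    [/\ open B, B !=set0, closure B `<=` p.2 `&` U p.1
      & forall a b, B a -> B b -> W p.1 (a - b)].
  case: p => n A /=; case: (pselect (open A /\ A !=set0)); last first.
    by move=> nA; exists set0 => oA A0; case: nA.
  move=> [oA A0]; have [x [Ax Ux]] := dU n A A0 oA.
  have /(metrizable_regular R X mX)[B xB cB] : nbhs x (A `&` U n).
    by apply: open_nbhs_nbhs; split => //; exact: openI.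
  have [C [oC Cx] CW] := nbhs_open_small X x (W n) (W0 n).
  exists (interior B `&` C) => _ _; split.
  - by apply: openI => //; exact: open_interior.
  - by exists x; split.
  - apply: subset_trans cB; apply: closure_subset.
    by move=> y [/interior_subset].
  - by move=> a b [_ Ca] [_ Cb]; exact: CW.
have [s sP] := choice refine.
pose F := fix F n := if n is m.+1 then s (m, F m) else O.
have F_open n : open (F n) /\ F n !=set0.
  by elim: n => [//|n [oF F0]] /=; have [] := sP (n, F n) oF F0.
have FP n : closure (F n.+1) `<=` F n `&` U n /\
    forall a b, F n.+1 a -> F n.+1 b -> W n (a - b).
  by have [oF F0] := F_open n; have [] := sP (n, F n) oF F0.
have F_decr m n : (m <= n)%N -> F n `<=` F m.
  move=> /subnK <-; elim: (n - m)%N => [//|k IH].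
  rewrite addSn; apply: subset_trans IH.
  by move=> y /subset_closure /(FP _).1 [].
pose G := filter_from [set: nat] F.
have GG : ProperFilter G.
  apply: filter_from_proper => [|n _]; last exact: (F_open n).2.
  apply: filter_from_filter; first by exists 0%N.
  move=> i j _ _; exists (maxn i j) => // y Fy.
  by split; [apply: F_decr (leq_maxl i j) _ Fy|apply: F_decr (leq_maxr i j) _ Fy].
have [x Gx] : exists x : X, G --> x.
  apply: (cX G GG) => A /Wbase[k WkA].
  exists (F k.+1, F k.+1); first by split; exists k.+1.
  by move=> [a b] /= [Fa Fb]; apply: WkA; exact: (FP k).2.
have clF n : closure (F n) x.
  move=> A /Gx[m _ FmA]; have [y Fy] := (F_open (maxn m n)).2.
  exists y; split; first by apply: F_decr (leq_maxr m n) _ Fy.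
  by apply: FmA; apply: F_decr (leq_maxl m n) _ Fy.
exists x; split; first by have [] := (FP 0%N).1 x (clF 1%N).
by move=> n _; have [] := (FP n).1 x (clF n.+1).
Qed.

(** * Transitivity and dense orbits *)

Lemma continuous_iter (X : topologicalType) (f : X -> X) n :
  continuous f -> continuous (iter n f).
Proof.
move=> cf; elim: n => [x|n IH x]; first exact: cvg_id.
exact: (continuous_comp (IH x) (cf (iter n f x))).
Qed.

(** The points with dense orbit contain the intersection over [n] of the sets
[U n] of points whose orbit meets [B n], and Baire's theorem applies to it. *)
Lemma topologically_transitive_hypercyclic (R : realType)
    (X : topologicalZmodType) (f : X -> X) :
  metrizable R X -> complete X -> separable X -> continuous f ->
  topologically_transitive f -> hypercyclic f.
Proof.
move=> mX cX sX cf tf.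
have X0 : [set: X] !=set0 by exists 0.
have [B oB Bbase] := metrizable_separable_countable_pi_base R X mX sX X0.
pose U n := \bigcup_k (iter k f @^-1` B n).
have oU n : open (U n).
  apply: bigcup_open => k _; apply: open_comp => [x _|]; last exact: (oB n).1.
  exact: continuous_iter.
have dU n : dense (U n).
  move=> O O0 oO; have [oBn Bn0] := oB n.
  have [k [_ [_ [[x Ox <-] Bx]]]] := tf O (B n) oO oBn O0 Bn0.
  by exists x; split => //; exists k.
have [x [_ Ux]] := metrizable_complete_baire R X U mX cX oU dU setT X0 openT.
exists x => O O0 oO; have [n BO] := Bbase O O0 oO.
have [k _ Bk] := Ux n I.
by exists (iter k f x); split; [exact: BO|exists k].
Qed.

(** In a finite open set all points but [x] form a closed set, so removing them
would leave [x] isolated. *)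
Lemma perfect_open_infinite (X : topologicalType) (V : set X) :
  accessible_space X -> perfect_set [set: X] ->
  open V -> V !=set0 -> infinite_set V.
Proof.
move=> aX /perfectTP pX oV [x Vx] fV; apply: (pX x).
have -> : [set x] = V `&` ~` (V `\ x).
  apply/seteqP; split => [_ -> |y [Vy nVy]]; first by split => //= -[_ /(_ erefl)].
  by apply: contrapT => yx; apply: nVy.
apply: openI => //; apply: closed_openC.
by apply: (accessible_finite_set_closed.1 aX); apply: sub_finite_set fV => y [].
Qed.

(** A second visit is wanted strictly after the first one.  Deleting from [V]
the finitely many points visited up to that time forces it. *)
Lemma hypercyclic_topologically_transitive (X : topologicalType) (f : X -> X) :
  accessible_space X -> perfect_set [set: X] ->
  hypercyclic f -> topologically_transitive f.
Proof.
move=> aX pX [x dx] U V oU oV U0 V0.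
have [y [Uy [n _ fnx]]] := dx U U0 oU.
pose past := (fun k => iter k f x) @` `I_n.+1.
have past_fin : finite_set past by exact: finite_image.
have [||z [[Vz pastz] [m _ fmx]]] := dx (V `\` past).
- by apply/infinite_setN0/infinite_setD => //; exact: perfect_open_infinite.
- rewrite setDE; apply: openI => //; apply: closed_openC.
  exact: accessible_finite_set_closed.1.
have nm : (n < m)%N.
  by rewrite ltnNge; apply/negP => mn; apply: pastz; exists m.
exists (m - n)%N; split; first by rewrite subn_gt0.
exists z; split => //; exists y => //.
by rewrite -fnx -iterD subnK// ltnW.
Qed.

(** * Absence of isolated points over a nontrivially valued field *)

Lemma valuation1 (R : realType) (K : nonArchFieldType R) :
  valuation (1 : K) = 1.
Proof.
have v1 : valuation (1 : K) != 0.
  by apply/eqP => /valuation_eq0/eqP; rewrite oner_eq0.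
by apply: (mulfI v1); rewrite -valuationM !mulr1.
Qed.

(** Either the scalar witnessing nontriviality or its inverse has valuation
below [1]. *)
Lemma nontrivial_valuation_lt1 (R : realType) (K : nonArchFieldType R) :
  nontrivial_valuation K -> exists2 c : K, c != 0 & valuation c < 1.
Proof.
move=> [x [x0 vx1]]; have [vx|vx] := ltP (valuation x) 1; first by exists x.
exists x^-1; first by rewrite invr_eq0.
have vx_gt1 : 1 < valuation x by rewrite lt_neqAle eq_sym vx1.
have : valuation x * valuation x^-1 = 1.
  by rewrite -valuationM divff// valuation1.
move/(canRL (mulKf _)) => ->; last by rewrite gt_eqF// (lt_trans ltr01).
by rewrite mulr1 invf_lt1// (lt_trans ltr01).
Qed.

Lemma valuationX (R : realType) (K : nonArchFieldType R) (c : K) n :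
  valuation (c ^+ n) = valuation c ^+ n.
Proof.
elim: n => [|n IH]; first by rewrite !expr0 valuation1.
by rewrite !exprS valuationM IH.
Qed.

(** The powers of a nonzero scalar of valuation below [1] tend to [0]. *)
Lemma nontrivial_valuation_nbhs0 (R : realType) (K : nonArchFieldType R)
    (A : set K) :
  nontrivial_valuation K -> nbhs 0 A -> exists2 c : K, A c & c != 0.
Proof.
move=> /nontrivial_valuation_lt1[c c0 vc1] /nbhs_ballP[e /= e0 eA].
have /cvgr0_norm_lt/(_ e e0)[n _ /(_ n (leqnn n))] :
    geometric 1 (valuation c) k @[k --> \oo] --> 0.
  by apply: cvg_geometric; rewrite ger0_norm// valuation_ge0.
rewrite /= mul1r ger0_norm ?exprn_ge0 ?valuation_ge0// => vcn.
exists (c ^+ n); last exact: expf_neq0.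
apply: eA; apply: ball_sym; rewrite ballEmdist /=.
by rewrite [mdist _ _](_ : _ = valuation (c ^+ n - 0))// subr0 valuationX.
Qed.

(** The points [c *: y + x] tend to [x] as [c] tends to [0] and differ from [x]
for [c != 0], so the singleton of [x] cannot be open. *)
Lemma topological_vector_space_perfect (R : realType) (K : nonArchFieldType R)
    (X : topVectorSpaceType K) (y : X) :
  nontrivial_valuation K -> y != 0 -> perfect_set [set: X].
Proof.
move=> vK y0; apply/perfectTP => x ox.
have FK : Filter (nbhs (0 : K)) by exact: nbhs_filter.
have cvgx : tvs_scale c y + x @[c --> (0 : K)] --> tvs_scale (0 : K) y + x.
  apply: (@continuous2_cvg _ _ _ _ _ FK _ _ (fun u v : X => u + v)).
  - exact: (@add_continuous X (_, _)).
  - apply: (@continuous2_cvg _ _ _ _ _ FK _ _ (fun (a : K) (u : X) => tvs_scale a u)).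
    + exact: (@tvs_scale_continuous R K X (_, _)).
    + exact: cvg_id.
    + exact: cvg_cst.
  - exact: cvg_cst.
have s0 : tvs_scale (0 : K) y = 0 by exact: (scale0r y).
have : nbhs (tvs_scale (0 : K) y + x) [set x].
  by apply: open_nbhs_nbhs; split => //=; rewrite s0 add0r.
move/cvgx/(nontrivial_valuation_nbhs0 R K _ vK) => -[c /= cyx c0].
have /eqP : c *: y = 0 by apply: (addIr x); rewrite add0r.
by rewrite scaler_eq0 (negPf c0) (negPf y0).
Qed.

Theorem theorem3p2 (R : realType) (K : nonArchFieldType R)
    (X : topVectorSpaceType K) (T : {linear X -> X}) :
  nontrivial_valuation K ->
  F_space X ->
  separable X ->
  continuous T ->
  (hypercyclic T <-> topologically_transitive T).
Proof.
move=> vK [mX cX] sX cT; split; last first.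
  exact: (topologically_transitive_hypercyclic R).
have [[y y0]|X0] := pselect (exists y : X, y != 0).
  apply: hypercyclic_topologically_transitive.
    exact: (metrizable_accessible R).
  exact: topological_vector_space_perfect y0.
have all0 (x : X) : x = 0.
  by apply/eqP/negPn/negP => x0; apply: X0; exists x.
move=> _ U V _ _ [u Uu] [v Vv]; exists 1%N; split => //.
exists v; split => //; exists u => //.
by rewrite (all0 v) (all0 (iter _ _ _)).
Qed.
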